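(* Let $K:\mathbb{N}_0\times\mathbb{N}_0\to\mathbb{C}$ be a kernel with $K(l,l)=1$ for all $l\ge 0$. Then $K$ is strictly positive definite if and only if there is a family $\{\gamma_{k,j}\}_{0\le k<j}$ of complex numbers, with $|\gamma_{k,j}|<1$ for all $k<j$, such that for $0\le l<m$ $$K(l,m)=\sum_{\mathbf{q}\in\mathcal{D}^l_m}\ \prod_{l\le i<j\le m}a_{i,j}(\mathbf{q}),$$ where $\mathcal{D}^l_m$ is the set of Dyck subpaths from $(2l,0)$ to $(2m,0)$ and $a_{i,j}(\mathbf{q})$ are the local weights determined by $\{\gamma_{k,j}\}$, both as defined in the context.
   Context: $\mathbb{N}_0=\{0,1,2,\dots\}$. A kernel $K:\mathbb{N}_0\times\mathbb{N}_0\to\mathbb{C}$ is positive definite if for all $n>0$, $p_1,\dots,p_n\in\mathbb{N}_0$ and $\lambda_1,\dots,\lambda_n\in\mathbb{C}$ one has $\sum_{k,j=1}^nK(p_k,p_j)\lambda_j\overline{\lambda}_k\ge 0$. It is strictly positive definite if all these inequalities are strict (for distinct $p_1,\dots,p_n$ and $\lambda_1,\dots,\lambda_n$ not all zero). For $0\le l\le m$, $\mathcal{D}^l_m$ is the set of lattice paths in $\mathbb{Z}^2$ that start at $(2l,0)$, end at $(2m,0)$, consist of rise steps $(1,1)$ and fall steps $(1,-1)$, and never go below the horizontal axis (so $\mathcal{D}^l_m$ is a translate of the set of Dyck paths of length $2(m-l)$). Given complex numbers $\gamma_{i,j}$ with $|\gamma_{i,j}|<1$, put $d_{i,j}=(1-|\gamma_{i,j}|^2)^{1/2}$.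 For $l\le i<j\le m$ and $\mathbf{q}\in\mathcal{D}^l_m$, let $x=(j+i,\,j-i)$ (a point of positive height) and define - $a_{i,j}(\mathbf{q})=1$ if $x$ is not a vertex of $\mathbf{q}$; - $a_{i,j}(\mathbf{q})=\gamma_{i,j}$ if $x$ is a vertex of $\mathbf{q}$ at which a rise step is followed by a fall step; - $a_{i,j}(\mathbf{q})=-\overline{\gamma}_{i,j}$ if $x$ is a vertex of $\mathbf{q}$ at which a fall step is followed by a rise step; - $a_{i,j}(\mathbf{q})=d_{i,j}$ if $x$ is a vertex of $\mathbf{q}$ at which two consecutive rise steps or two consecutive fall steps meet.
   Formalization: The condition K(m,l) = conjugate of K(l,m) is added beside the family γ: the formula fixes K(l,m) only for l<m, so without it ''if'' is false (γ=0 and K(m,l)=1 for l<m gives a kernel that is not positive definite). *)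

(* Defs.v *)
From HB Require Import structures.
From mathcomp Require Import all_boot all_order all_algebra.
From mathcomp Require Import reals complex.

Set Implicit Arguments.
Unset Strict Implicit.
Unset Printing Implicit Defensive.

Import Order.TTheory GRing.Theory Num.Theory.
Local Open Scope ring_scope.
Local Open Scope complex_scope.

(* The order of [R[i]] is partial: [0 < z] says that [z] is real and positive. *)
Definition strictly_positive_definite (R : realType)
    (K : nat -> nat -> R[i]) : Prop :=
  forall (n : nat) (p : 'I_n -> nat) (lambda : 'I_n -> R[i]),
    (0 < n)%N -> injective p -> (exists k, lambda k != 0) ->
    0 < \sum_(k < n) \sum_(j < n)
          K (p k) (p j) * lambda j * Num.conj (lambda k).

(* Implied by positive definiteness.  It has to accompany the formula for
   [K l m] with [l < m], which says nothing about [K m l]. *)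
Definition hermitian_kernel (R : realType) (K : nat -> nat -> R[i]) : Prop :=
  forall l m, K m l = Num.conj (K l m).

(* A path starting at a given point is encoded by its sequence of steps,
   [true] being a rise and [false] a fall. *)
Definition step (b : bool) : int * int := if b then (1, 1) else (1, -1).

Definition vertices (l : nat) (q : seq bool) : seq (int * int) :=
  let o : int * int := ((2 * l)%N%:Z, 0) in
  o :: scanl (fun v b => v + step b) o q.

(* Each step advances the abscissa by 1, so that a path from [(2l, 0)] to
   [(2m, 0)] has exactly [2 (m - l)] steps. *)
Definition dyck_paths (l m : nat) : {set (2 * (m - l)).-tuple bool} :=
  [set q : (2 * (m - l)).-tuple bool |
     (last (0, 0) (vertices l q) == ((2 * m)%N%:Z, 0))
     && all (fun v => 0 <= v.2) (vertices l q)].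

(* The vertex of index [k] lies between the steps of indices [k.-1] and [k].
   For [q] in [dyck_paths l m] and [l <= i < j <= m], [x] has positive height,
   hence it is not an endpoint of [q] and both steps exist. *)
Definition weight (R : realType) (gamma : nat -> nat -> R[i]) (l : nat)
    (q : seq bool) (i j : nat) : R[i] :=
  let x : int * int := (j%:Z + i%:Z, j%:Z - i%:Z) in
  let k := index x (vertices l q) in
  if x \notin vertices l q then 1 else
  match nth true q k.-1, nth true q k with
  | true, false => gamma i j
  | false, true => - Num.conj (gamma i j)
  | _, _ => sqrtC (1 - `|gamma i j| ^+ 2)
  end.

(* Main.v *)
(* A path is read as a wave running through a lattice of 2 x 2 unitary matrices
   [[d, -gamma^*], [gamma, d]], one at each point (i, j) of positive height, which
   mix an incoming rising edge with an incoming falling one.  Suppose that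
   vectors r_(i,j) and f_(i,j), attached to the rising and falling edges, obey
   the same local recursion, with r_(k,k) = f_(k,k) = x_k, and that f_(l,j) is
   orthogonal to x_l for j > l.  Pairing the recursion with x_l then shows that
   the sum over the paths from l to m is the inner product of x_m with x_l.
   Given a strictly positive definite K, take x_k = 'X^k in the space of
   polynomials with the inner product defined by K; Gram-Schmidt, organized as
   the Szego recursion, yields the edge vectors, and gamma_(i,j) is the inner
   product of the two unit vectors entering the recursion, hence is less than 1
   in modulus by strict Cauchy-Schwarz.  Conversely, given gamma, start from
   the standard orthonormal basis and run the recursion: unitarity keeps every
   row orthonormal, and x_k has degree exactly k because d > 0, so that K is
   the Gram matrix of linearly independent vectors. *)
Require Import Defs.
From mathcomp Require Import all_boot all_order all_algebra.
From mathcomp Require Import reals complex.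
From mathcomp Require Import ring zify.

Set Implicit Arguments.
Unset Strict Implicit.
Unset Printing Implicit Defensive.

Import Order.TTheory GRing.Theory Num.Theory.
Local Open Scope ring_scope.


(** * Sesquilinear forms defined by a kernel *)

Section Form.
Variables (C : numClosedFieldType) (A : nat -> nat -> C).
Implicit Types (a : C) (p q r s : {poly C}).

(** Polynomials serve as finitely supported sequences. The form is linear in [p] and
    conjugate-linear in [q], hence [A k j] pairs ['X^j] with ['X^k], in this order. *)
Definition kform p q : C :=
  \sum_(k < size q) \sum_(j < size p) A k j * p`_j * Num.conj q`_k.

Lemma kformE (M N : nat) p q : (size p <= M)%N -> (size q <= N)%N ->
  kform p q = \sum_(k < N) \sum_(j < M) A k j * p`_j * Num.conj q`_k.
Proof.
move=> leM leN; rewrite /kform.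
under eq_bigr => k _.
  rewrite (big_ord_widen M (fun j => A k j * p`_j * Num.conj q`_k)) //.
  rewrite big_mkcond /=.
  under eq_bigr => j _.
    rewrite (_ : (if _ then _ else _) = A k j * p`_j * Num.conj q`_k); last first.
      by case: ltnP => // /(nth_default 0) ->; rewrite mulr0 mul0r.
    over.
  over.
rewrite (big_ord_widen N (fun k => \sum_(j < M) A k j * p`_j * Num.conj q`_k)) //.
rewrite big_mkcond /=; apply: eq_bigr => k _.
case: ltnP => // /(nth_default 0) ->; rewrite big1 // => j _.
by rewrite conjC0 mulr0.
Qed.

Lemma kform_linearl a p q s : kform (a *: p + q) s = a * kform p s + kform q s.
Proof.
set M := maxn (size p) (size q).
have leM : (size (a *: p + q)%R <= M)%N.
  apply: leq_trans (size_polyD _ _) _; rewrite geq_max /M leq_maxr andbT.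
  exact: leq_trans (size_scale_leq _ _) (leq_maxl _ _).
rewrite (kformE leM (leqnn _)) (kformE (leq_maxl _ _ : _ <= M)%N (leqnn _)).
rewrite (kformE (leq_maxr _ _ : _ <= M)%N (leqnn (size s))).
rewrite mulr_sumr -big_split; apply: eq_bigr => k _.
rewrite mulr_sumr -big_split; apply: eq_bigr => j _ /=.
by rewrite coefD coefZ; ring.
Qed.

Lemma kformZl a p s : kform (a *: p) s = a * kform p s.
Proof.
have := kform_linearl a p 0 s; rewrite addr0 => ->.
rewrite [kform 0 s]/kform size_poly0 [X in _ + X]big1 ?addr0 // => k _.
by rewrite big_ord0.
Qed.

Lemma kformDl p q s : kform (p + q) s = kform p s + kform q s.
Proof. by have := kform_linearl 1 p q s; rewrite scale1r mul1r. Qed.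

Lemma kform_suml (I : finType) (F : I -> {poly C}) s :
  kform (\sum_i F i) s = \sum_i kform (F i) s.
Proof.
apply: (big_morph (kform^~ s)) => [p q|]; first exact: kformDl.
by rewrite -[0 in LHS](scale0r 0) kformZl mul0r.
Qed.

Lemma kform_Xnr p k : kform p 'X^k = \sum_(j < size p) A k j * p`_j.
Proof.
rewrite /kform size_polyXn big_ord_recr /= [X in X + _]big1 => [|i _].
  by rewrite add0r; apply: eq_bigr => j _; rewrite coefXn eqxx conjC1 mulr1.
by rewrite big1 // => j _; rewrite coefXn (ltn_eqF (ltn_ord i)) conjC0 mulr0.
Qed.

Lemma kform_coefr p q : kform p q = \sum_(k < size q) Num.conj q`_k * kform p 'X^k.
Proof.
apply: eq_bigr => k _; rewrite kform_Xnr mulr_sumr.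
by apply: eq_bigr => j _; ring.
Qed.

Lemma kformXn j k : kform 'X^j 'X^k = A k j.
Proof.
rewrite kform_Xnr size_polyXn big_ord_recr /= [X in X + _]big1 ?add0r => [|i _].
  by rewrite coefXn eqxx mulr1.
by rewrite coefXn (ltn_eqF (ltn_ord i)) mulr0.
Qed.

Hypothesis Aherm : forall l m, A m l = Num.conj (A l m).

Lemma kform_herm p q : kform q p = Num.conj (kform p q).
Proof.
rewrite /kform rmorph_sum; under [RHS]eq_bigr => k _ do rewrite rmorph_sum.
rewrite [RHS]exchange_big /=; apply: eq_bigr => k _; apply: eq_bigr => j _.
rewrite !rmorphM /= (Aherm j k) conjCK.
by rewrite mulrAC.
Qed.

Lemma kformDr p q s : kform p (q + s) = kform p q + kform p s.
Proof. by rewrite kform_herm kformDl rmorphD /= -!kform_herm. Qed.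

Lemma kformZr a p s : kform p (a *: s) = Num.conj a * kform p s.
Proof. by rewrite kform_herm kformZl rmorphM /= -kform_herm. Qed.

Lemma kform_sumr (I : finType) (F : I -> {poly C}) s :
  kform s (\sum_i F i) = \sum_i kform s (F i).
Proof.
rewrite kform_herm kform_suml rmorph_sum; apply: eq_bigr => i _.
by rewrite [RHS]kform_herm.
Qed.

End Form.

(** * The diagonal entry of the elementary unitary matrices *)

Definition julia_d (C : numClosedFieldType) (g : C) : C := sqrtC (1 - `|g| ^+ 2).

Section JuliaD.
Variables (C : numClosedFieldType) (g : C).
Hypothesis g1 : `|g| < 1.

Lemma julia_d_gt0 : 0 < julia_d g.
Proof. by rewrite sqrtC_gt0 subr_gt0 expr_lt1. Qed.

Lemma julia_d_neq0 : julia_d g != 0.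
Proof. by rewrite gt_eqF ?julia_d_gt0. Qed.

Lemma conj_julia_d : Num.conj (julia_d g) = julia_d g.
Proof. by rewrite geC0_conj ?ltW ?julia_d_gt0. Qed.

Lemma julia_d_sqr : julia_d g * julia_d g = 1 - g * Num.conj g.
Proof. by rewrite -expr2 sqrtCK normCK. Qed.

End JuliaD.

(** * From a kernel to its parameters *)

Section SchurAlgorithm.
Variables (C : numClosedFieldType) (K : nat -> nat -> C).
Hypothesis Kherm : forall l m, K m l = Num.conj (K l m).
Hypothesis K1 : forall l, K l l = 1.
Hypothesis Kpos : forall p : {poly C}, p != 0 -> 0 < kform K p p.

Local Notation B := (kform K).

(* The components of [schur n i] are, up to normalization, the residues of ['X^i]
   modulo ['X^(i.+1)], ..., ['X^(i + n)], and of ['X^(i + n)] modulo ['X^i], ...,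
   ['X^((i + n).-1)]. *)
Fixpoint schur (n i : nat) : {poly C} * {poly C} :=
  if n is n'.+1 then
    let r := (schur n' i).1 in
    let u := (schur n' i.+1).2 in
    let c := B u r in
    ((julia_d c)^-1 *: (r - Num.conj c *: u), (julia_d c)^-1 *: (u - c *: r))
  else ('X^i, 'X^i).

Definition rise_vec i j := (schur (j - i) i).1.
Definition fall_vec i j := (schur (j - i) i).2.
Definition schur_param i j := B (fall_vec i.+1 j) (rise_vec i j.-1).

(** When [B p q] is expanded along the coefficients of [q], only the term of index [i] survives.
    Orthogonality to a vector thus becomes orthogonality to one more monomial. *)
Lemma orthoXn_of_form (p q : {poly C}) (i : nat) (D : pred nat) :
  (forall k, D k -> B p 'X^k = 0) -> (forall k, ~~ D k -> k != i -> q`_k = 0) ->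
  q`_i != 0 -> B p q = 0 -> B p 'X^i = 0.
Proof.
move=> pD qD qi; rewrite kform_coefr.
have ilt : (i < size q)%N.
  by rewrite ltnNge; apply: contra qi => /(nth_default 0) ->.
rewrite (bigD1 (Ordinal ilt)) //= big1 ?addr0 => [|k ki].
  by move/eqP; rewrite mulf_eq0 conjC_eq0 (negPf qi) => /eqP.
case: (boolP (D k)) => [/pD->|/qD->]; rewrite ?mulr0 // ?conjC0 ?mul0r //.
Qed.

Lemma kform_residue (a : C) (p q : {poly C}) : B p p = 1 -> B q q = 1 -> a = B p q ->
  B (p - a *: q) (p - a *: q) = 1 - a * Num.conj a.
Proof.
move=> p1 q1 aE; rewrite -scaleNr kformDl !kformDr // !kformZl !kformZr //.
rewrite (kform_herm Kherm p q) p1 q1 -aE rmorphN /=; ring.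
Qed.

(** Strict Cauchy-Schwarz: the residue has squared norm [1 - |B p q|^2]. *)
Lemma normC_kform_lt1 (p q : {poly C}) :
  B p p = 1 -> B q q = 1 -> p - B p q *: q != 0 -> `|B p q| < 1.
Proof.
move=> p1 q1 /Kpos; rewrite kform_residue // -normCK subr_gt0.
by rewrite expr_lt1.
Qed.

(** The nonzero end coefficients, together with the supports, make Cauchy-Schwarz strict and let the
    next step gain a monomial through [orthoXn_of_form]. *)
Record schur_inv n i (r g : {poly C}) : Prop := SchurInv {
  schur_rise1 : B r r = 1;
  schur_fall1 : B g g = 1;
  schur_rise_ortho : forall k, (i < k <= i + n)%N -> B r 'X^k = 0;
  schur_fall_ortho : forall k, (i <= k < i + n)%N -> B g 'X^k = 0;
  schur_rise_coef : r`_i != 0;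
  schur_fall_coef : g`_(i + n) != 0;
  schur_rise_supp : forall k, ~~ (i <= k <= i + n)%N -> r`_k = 0;
  schur_fall_supp : forall k, ~~ (i <= k <= i + n)%N -> g`_k = 0 }.

Lemma schur_param_lt1 n i r g r' u :
  schur_inv n i r g -> schur_inv n i.+1 r' u -> `|B u r| < 1.
Proof.
case=> r1 _ _ _ _ _ rs _ [_ u1 _ _ _ uc _ _]; apply: normC_kform_lt1 => //.
(* The coefficient of index [i.+1 + n] is nonzero in [u] and lies beyond the support of [r], so the
   residue cannot vanish. *)
apply/eqP => /(congr1 (fun p : {poly C} => p`_(i.+1 + n))) /eqP.
by rewrite coefB coefZ rs ?mulr0 ?subr0 ?coef0 ?(negPf uc) //; lia.
Qed.

(** Both residues stay orthogonal to the monomials common to the two windows. Each is also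
    orthogonal to the other input, whose support has a single further monomial: this is the one
    gained. *)
Lemma schur_step n i r g r' u (c := B u r) :
  schur_inv n i r g -> schur_inv n i.+1 r' u ->
  schur_inv n.+1 i ((julia_d c)^-1 *: (r - Num.conj c *: u))
                   ((julia_d c)^-1 *: (u - c *: r)).
Proof.
move=> ir iu; have /= c1 := schur_param_lt1 ir iu; rewrite -/c in c1.
have d0 := julia_d_neq0 c1; have dC := conj_julia_d c1; have dd := julia_d_sqr c.
case: ir iu => r1 _ ro _ rc _ rs _ [_ u1 _ uo _ uc _ us].
have cE : Num.conj c = B r u by rewrite (kform_herm Kherm).
set d := julia_d c in d0 dC dd *.
have normd p : B p p = d * d -> B (d^-1 *: p) (d^-1 *: p) = 1.
  by move=> pE; rewrite kformZl kformZr // fmorphV /= dC pE; field.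
have rD k : (i < k <= i + n)%N -> B (r - Num.conj c *: u) 'X^k = 0.
  move=> k_in; rewrite -scaleNr kformDl kformZl ro // uo ?mulr0 ?addr0 //; lia.
have uD k : (i < k <= i + n)%N -> B (u - c *: r) 'X^k = 0.
  move=> k_in; rewrite -scaleNr kformDl kformZl ro // uo ?mulr0 ?addr0 //; lia.
have rX : B (r - Num.conj c *: u) 'X^(i.+1 + n) = 0.
  apply: (orthoXn_of_form rD) uc _ => [k nk ki|]; first by apply: us; lia.
  by rewrite -scaleNr kformDl kformZl u1 -cE mulr1 addrN.
have uX : B (u - c *: r) 'X^i = 0.
  apply: (orthoXn_of_form uD) rc _ => [k nk ki|]; first by apply: rs; lia.
  by rewrite -scaleNr kformDl kformZl r1 mulr1 addrN.
split.
- by apply: normd; rewrite kform_residue // conjCK dd mulrC.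
- by apply: normd; rewrite kform_residue.
- move=> k k_in; rewrite kformZl; have [->|kn] := eqVneq k (i.+1 + n)%N.
    by rewrite rX mulr0.
  by rewrite rD ?mulr0 //; lia.
- move=> k k_in; rewrite kformZl; have [->|kn] := eqVneq k i.
    by rewrite uX mulr0.
  by rewrite uD ?mulr0 //; lia.
- by rewrite coefZ coefB coefZ us ?mulr0 ?subr0 ?mulf_neq0 ?invr_eq0 //; lia.
- rewrite addnS -addSn coefZ coefB coefZ rs ?mulr0 ?subr0 ?mulf_neq0 ?invr_eq0 //; lia.
- by move=> k nk; rewrite coefZ coefB coefZ rs ?us ?mulr0 ?subr0 ?mulr0 //; lia.
- by move=> k nk; rewrite coefZ coefB coefZ rs ?us ?mulr0 ?subr0 ?mulr0 //; lia.
Qed.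

Lemma schurP n i : schur_inv n i (schur n i).1 (schur n i).2.
Proof.
elim: n i => [|n IHn] i; last exact: schur_step (IHn i) (IHn i.+1).
split=> /=; rewrite ?kformXn ?addn0 ?coefXn ?eqxx ?oner_neq0 //.
- by move=> k; lia.
- by move=> k; lia.
- by move=> k nk; rewrite coefXn; case: eqP => // ki; lia.
- by move=> k nk; rewrite coefXn; case: eqP => // ki; lia.
Qed.

Lemma schur_paramE i j : (i <= j)%N ->
  schur_param i j.+1 = B (schur (j - i) i.+1).2 (schur (j - i) i).1.
Proof. by rewrite /schur_param /fall_vec /rise_vec subSS. Qed.

Lemma norm_schur_param i j : (i < j)%N -> `|schur_param i j| < 1.
Proof.
case: j => // j ij; rewrite schur_paramE //.
exact: schur_param_lt1 (schurP _ _) (schurP _ _).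
Qed.

(** At a lattice point, [schur] computes the outgoing rise and the incoming fall from the incoming
    rise and the outgoing fall. Solving for the two outgoing vectors turns this hyperbolic form into
    the unitary one. *)
Lemma rise_vecS i j (c := schur_param i j.+1) : (i <= j)%N ->
  rise_vec i j.+1 = julia_d c *: rise_vec i j - Num.conj c *: fall_vec i j.+1.
Proof.
move=> ij; have c1 : `|c| < 1 by apply: norm_schur_param.
have d0 := julia_d_neq0 c1; have dd := julia_d_sqr c.
rewrite /rise_vec /fall_vec subSn //= -schur_paramE // -/c.
move: (schur _ _).1 (schur _ _).2 => r u.
(* This is [d^2 + |c|^2 = 1] divided by [d]. *)
have dE : julia_d c + Num.conj c * (julia_d c)^-1 * c = (julia_d c)^-1.
  by apply: (mulfI d0); rewrite mulrDr dd; field.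
rewrite !scalerBr !scalerA opprB addrA -scalerDl dE.
by rewrite [Num.conj c * _]mulrC.
Qed.

Lemma fall_vecS i j (c := schur_param i j.+1) : (i <= j)%N ->
  fall_vec i.+1 j.+1 = c *: rise_vec i j + julia_d c *: fall_vec i j.+1.
Proof.
move=> ij; have c1 : `|c| < 1 by apply: norm_schur_param.
have d0 := julia_d_neq0 c1.
rewrite /rise_vec /fall_vec subSS subSn //= -schur_paramE // -/c.
by rewrite scalerA divff // scale1r addrC subrK.
Qed.

End SchurAlgorithm.

(** * From parameters to a Gram matrix *)

Section Cascade.
Variables (C : numClosedFieldType) (gamma : nat -> nat -> C).
Hypothesis gamma1 : forall k j, (k < j)%N -> `|gamma k j| < 1.

Definition delta_kernel (k j : nat) : C := (k == j)%:R.

Lemma delta_kernel_herm l m : delta_kernel m l = Num.conj (delta_kernel l m).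
Proof. by rewrite /delta_kernel eq_sym rmorph_nat. Qed.

Local Notation B := (kform delta_kernel).

Lemma kform_delta_gt0 (p : {poly C}) : p != 0 -> 0 < B p p.
Proof.
move=> p0; have -> : B p p = \sum_(k < size p) `|p`_k| ^+ 2.
  apply: eq_bigr => k _; rewrite (bigD1 k) //= big1 => [|j jk].
    by rewrite /delta_kernel eqxx mul1r addr0 normCK.
  by rewrite /delta_kernel eq_sym -val_eqE /= in jk *; rewrite (negPf jk) !mul0r.
have sp : ((size p).-1 < size p)%N by rewrite prednK ?size_poly_gt0.
rewrite (bigD1 (Ordinal sp)) //=; apply: ltr_wpDr.
  by apply: sumr_ge0 => k _; rewrite exprn_ge0.
by rewrite exprn_gt0 // normr_gt0 -lead_coefE lead_coef_eq0.
Qed.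

(** The falling row of index [i] enters as the function [g], which separates the recursion along a
    row from the recursion between rows in [cascade_fall]. *)
Fixpoint cascade_rise (i : nat) (g : nat -> {poly C}) (n : nat) : {poly C} :=
  if n is n'.+1 then
    julia_d (gamma i (i + n)) *: cascade_rise i g n'
    - Num.conj (gamma i (i + n)) *: g (i + n)%N
  else g i.

Fixpoint cascade_fall (i j : nat) : {poly C} :=
  if i is i'.+1 then
    gamma i' j *: cascade_rise i' (cascade_fall i') (j.-1 - i')
    + julia_d (gamma i' j) *: cascade_fall i' j
  else 'X^j.

Definition cascade_rise_vec i j := cascade_rise i (cascade_fall i) (j - i).

Lemma cascade_rise_vecii i : cascade_rise_vec i i = cascade_fall i i.
Proof. by rewrite /cascade_rise_vec subnn. Qed.

Lemma cascade_rise_vecS i j (c := gamma i j.+1) : (i <= j)%N ->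
  cascade_rise_vec i j.+1
  = julia_d c *: cascade_rise_vec i j - Num.conj c *: cascade_fall i j.+1.
Proof. by move=> ij; rewrite /cascade_rise_vec subSn //= -subSn // subnKC // ltnW. Qed.

Lemma cascade_fallS i j (c := gamma i j.+1) :
  cascade_fall i.+1 j.+1
  = c *: cascade_rise_vec i j + julia_d c *: cascade_fall i j.+1.
Proof. by []. Qed.

Lemma size_cascade_rise_le i :
  (forall j, (i <= j)%N -> size (cascade_fall i j) = j.+1) ->
  forall j, (i <= j)%N -> (size (cascade_rise_vec i j) <= j.+1)%N.
Proof.
move=> sg j /subnK <-; elim: (j - i)%N => [|n IHn].
  by rewrite cascade_rise_vecii sg.
rewrite addSn cascade_rise_vecS ?leq_addl // -scaleNr.
apply: leq_trans (size_polyD _ _) _; rewrite geq_max.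
rewrite (leq_trans (size_scale_leq _ _)) ?(leq_trans IHn) //=.
by rewrite (leq_trans (size_scale_leq _ _)) // sg //; lia.
Qed.

(** The rising term has lower degree than the falling one, whose factor [julia_d] is nonzero; the
    leading term therefore survives from row to row. *)
Lemma size_cascade_fall i j : (i <= j)%N -> size (cascade_fall i j) = j.+1.
Proof.
elim: i j => [|i IHi] [|j] // ij; rewrite ?size_polyXn //.
have d0 := julia_d_neq0 (gamma1 ij).
have sf : size (julia_d (gamma i j.+1) *: cascade_fall i j.+1) = j.+2.
  by rewrite size_scale // IHi // ltnW.
rewrite cascade_fallS (addrC (_ *: cascade_rise_vec _ _)) size_polyDl sf //.
apply: leq_ltn_trans (size_scale_leq _ _) _.
exact: size_cascade_rise_le IHi _ ij.
Qed.

Let BDl := kformDl delta_kernel.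
Let BZl := kformZl delta_kernel.
Let BDr := kformDr delta_kernel_herm.
Let BZr := kformZr delta_kernel_herm.

Section Row.
Variable i : nat.
Hypothesis fall_orthonormal : forall j k, (i <= j)%N -> (i <= k)%N ->
  B (cascade_fall i j) (cascade_fall i k) = (j == k)%:R.

Lemma cascade_rise_unit_ortho j : (i <= j)%N ->
  B (cascade_rise_vec i j) (cascade_rise_vec i j) = 1 /\
  forall k, (j < k)%N -> B (cascade_rise_vec i j) (cascade_fall i k) = 0.
Proof.
move=> /subnK <-; elim: (j - i)%N => [|n [r1 rg]].
  rewrite add0n cascade_rise_vecii fall_orthonormal // eqxx; split=> // k ik.
  by rewrite fall_orthonormal ?(ltn_eqF ik) // ltnW.
have ini : (i <= n + i)%N by rewrite leq_addl.
rewrite addSn cascade_rise_vecS // -scaleNr.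
set c := gamma _ _; have c1 : `|c| < 1 by apply: gamma1.
split=> [|k jk].
  rewrite BDl !BDr !BZl !BZr r1 fall_orthonormal ?eqxx ?(leqW ini) //.
  rewrite rg // (kform_herm delta_kernel_herm) rg // conjC0.
  rewrite conj_julia_d // rmorphN /= conjCK mulr1 julia_d_sqr; ring.
by rewrite BDl !BZl rg ?fall_orthonormal ?(ltn_eqF jk) ?mulr0 ?addr0 //; lia.
Qed.

Lemma cascade_fall_row_ortho j k : (i < j < k)%N ->
  B (cascade_fall i k) (cascade_fall i.+1 j) = 0.
Proof.
case: j => // j /andP[ij jk]; rewrite cascade_fallS BDr !BZr.
rewrite fall_orthonormal ?(gtn_eqF jk) ?mulr0 ?addr0; try lia.
rewrite (kform_herm delta_kernel_herm).
by rewrite (cascade_rise_unit_ortho _).2 ?conjC0 ?mulr0 //; lia.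
Qed.

(** For [k = j] the two vectors are the outputs of one unitary matrix, whose rows are orthogonal.
    For larger [j] each term of the recursion is separately orthogonal. *)
Lemma cascade_rise_row_ortho j k : (i < k <= j)%N ->
  B (cascade_rise_vec i j) (cascade_fall i.+1 k) = 0.
Proof.
move=> /andP[ik]; have ij0 := ltnW ik.
move=> kj; have /subnK jE := leq_trans ij0 kj.
rewrite -jE in kj *; elim: (j - i)%N kj => [|n IHn]; first by lia.
have ini : (i <= n + i)%N by rewrite leq_addl.
rewrite addSn cascade_rise_vecS // -scaleNr BDl !BZl.
rewrite leq_eqVlt => /predU1P[->|kn].
  have [r1 rg] := cascade_rise_unit_ortho ini.
  rewrite cascade_fallS !BDr !BZr r1 fall_orthonormal ?eqxx ?(leqW ini) //.
  rewrite rg // (kform_herm delta_kernel_herm) rg // conjC0 conj_julia_d ?gamma1 //.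
  by rewrite mulr1n; ring.
by rewrite IHn // cascade_fall_row_ortho ?ik //; ring.
Qed.

End Row.

Lemma cascade_fall_orthonormal i j k : (i <= j)%N -> (i <= k)%N ->
  B (cascade_fall i j) (cascade_fall i k) = (j == k)%:R.
Proof.
elim: i j k => [|i IHi] j k; first by rewrite /= kformXn /delta_kernel eq_sym.
wlog jk : j k / (k <= j)%N => [H ij ik|].
  case: (leqP k j) => kj; first exact: H.
  rewrite (kform_herm delta_kernel_herm) H //; last exact: ltnW.
  by rewrite rmorph_nat eq_sym.
case: j jk => // j jk ij ik; rewrite {1}cascade_fallS BDl !BZl.
move: jk; rewrite leq_eqVlt => /predU1P[->|kj].
  have [r1 rg] := cascade_rise_unit_ortho IHi ij.
  rewrite eqxx cascade_fallS !BDr !BZr r1 rg //.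
  rewrite (kform_herm delta_kernel_herm (cascade_rise_vec _ _)) rg // conjC0.
  rewrite IHi ?(ltnW ij) // ?eqxx ?mulr1n conj_julia_d ?gamma1 //.
  by rewrite !mulr1 !mulr0 addr0 add0r julia_d_sqr; ring.
rewrite cascade_rise_row_ortho // ?ik // cascade_fall_row_ortho ?ik //.
by rewrite (gtn_eqF kj) !mulr0 addr0.
Qed.

End Cascade.

(** * Sums over Dyck paths *)

(* The pair [(i, j)] stands for the lattice point [(j + i, j - i)]: a rise
   increments [j] and a fall increments [i]. *)
Definition nat_step (v : nat * nat) (b : bool) : nat * nat :=
  if b then (v.1, v.2.+1) else (v.1.+1, v.2).

Definition nat_vertices (v : nat * nat) (q : seq bool) := v :: scanl nat_step v q.

Definition plane_point (v : nat * nat) : int * int :=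
  (v.2%:Z + v.1%:Z, v.2%:Z - v.1%:Z).

Lemma plane_point_inj : injective plane_point.
Proof. by move=> [i j] [i' j'] [] /= e1 e2; congr (_, _); lia. Qed.

Lemma plane_point_step v b : plane_point (nat_step v b) = plane_point v + step b.
Proof. by case: v b => i j [] /=; congr (_, _) => /=; lia. Qed.

Lemma vertices_plane l q : vertices l q = map plane_point (nat_vertices (l, l) q).
Proof.
have ol : ((2 * l)%N%:Z, 0) = plane_point (l, l) by congr (_, _) => /=; lia.
rewrite /vertices /= ol; congr (_ :: _); move: (l, l) => v.
by elim: q v => //= b q IHq v; rewrite -plane_point_step IHq.
Qed.

Definition nat_end l (q : seq bool) := foldl nat_step (l, l) q.

Definition nonneg_path l (q : seq bool) :=
  all (fun v : nat * nat => v.1 <= v.2)%N (nat_vertices (l, l) q).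

Lemma last_scanl (T U : Type) (f : T -> U -> T) x s :
  last x (scanl f x s) = foldl f x s.
Proof. by elim: s x => /=. Qed.

Lemma mem_dyck_paths l m (q : (2 * (m - l)).-tuple bool) :
  (q \in dyck_paths l m) = nonneg_path l q && (nat_end l q == (m, m)).
Proof.
rewrite inE andbC vertices_plane all_map; congr (_ && _).
  by apply: eq_all => -[i j] /=; rewrite subr_ge0 lez_nat.
have -> : ((2 * m)%N%:Z, 0) = plane_point (m, m) by congr (_, _) => /=; lia.
by rewrite /= last_map last_scanl (inj_eq plane_point_inj).
Qed.

Lemma nonneg_path_rcons l q b :
  nonneg_path l (rcons q b) =
  nonneg_path l q && let v := nat_end l (rcons q b) in (v.1 <= v.2)%N.
Proof.
by rewrite /nonneg_path /nat_vertices scanl_rcons -rcons_cons all_rcons andbC.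
Qed.

Lemma nat_end_rcons l q b : nat_end l (rcons q b) = nat_step (nat_end l q) b.
Proof. by rewrite /nat_end foldl_rcons. Qed.

Lemma nonneg_path_end l q : nonneg_path l q -> ((nat_end l q).1 <= (nat_end l q).2)%N.
Proof. by case/lastP: q => [|q b] //; rewrite nonneg_path_rcons => /andP[]. Qed.

Lemma foldl_nat_step_ge v q :
  (v.1 <= (foldl nat_step v q).1)%N && (v.2 <= (foldl nat_step v q).2)%N.
Proof.
elim: q v => [|b q IHq] v /=; first by rewrite !leqnn.
have /andP[] := IHq (nat_step v b); case: b => /= le1 le2.
  by rewrite le1 ltnW.
by rewrite le2 (ltnW le1).
Qed.

Lemma foldl_nat_step_sum v q :
  ((foldl nat_step v q).1 + (foldl nat_step v q).2 = v.1 + v.2 + size q)%N.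
Proof. by elim: q v => [|b q IHq] v /=; rewrite ?addn0 // IHq; case: b => /=; lia. Qed.

Lemma size_nat_vertices v q : size (nat_vertices v q) = (size q).+1.
Proof. by rewrite /= size_scanl. Qed.

Lemma nth_nat_vertices x v q k : (k <= size q)%N ->
  nth x (nat_vertices v q) k = foldl nat_step v (take k q).
Proof. by move=> kq; rewrite nth_cons_scanl. Qed.

(** The sum of the coordinates grows by one at each step. *)
Lemma nat_vertices_uniq v q : uniq (nat_vertices v q).
Proof.
apply/(uniqP (0%N, 0%N)) => k k'; rewrite !inE size_nat_vertices !ltnS => kq kq'.
rewrite !nth_nat_vertices // => /(congr1 (fun v => v.1 + v.2)%N).
by rewrite !foldl_nat_step_sum !size_takel //; lia.
Qed.

Section PathSum.
Variables (R : realType) (gamma : nat -> nat -> R[i]).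

Definition turn_weight (v : nat * nat) (b c : bool) : R[i] :=
  if (v.1 < v.2)%N then
    match b, c with
    | true, false => gamma v.1 v.2
    | false, true => - Num.conj (gamma v.1 v.2)
    | _, _ => julia_d (gamma v.1 v.2)
    end
  else 1.

(** Following the path rather than the triangle of pairs makes the weight multiplicative when a step
    is appended. Only inner vertices occur, so the default [true] is never read. *)
Definition path_weight l (q : seq bool) : R[i] :=
  \prod_(1 <= k < size q)
     turn_weight (nat_end l (take k q)) (nth true q k.-1) (nth true q k).

Lemma path_weight_rcons l q b c :
  path_weight l (rcons (rcons q b) c) =
  path_weight l (rcons q b) * turn_weight (nat_end l (rcons q b)) b c.
Proof.
rewrite /path_weight !size_rcons big_nat_recr //=; congr (_ * _).
  apply: eq_big_nat => k /andP[k0 kq]; rewrite !(nth_rcons _ _ c) size_rcons.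
  rewrite kq (leq_ltn_trans (leq_pred k)) //.
  by rewrite -[X in take k X]cats1 takel_cat // size_rcons ltnW.
have -> : take (size q).+1 (rcons (rcons q b) c) = rcons q b.
  by rewrite -(size_rcons q b) -[X in take _ X]cats1 take_size_cat.
by rewrite !nth_rcons size_rcons ltnSn !ltnn !eqxx.
Qed.

Lemma weight_nat_vertices l q k : (k <= size q)%N ->
  let v := nat_end l (take k q) in (v.1 < v.2)%N ->
  weight gamma l q v.1 v.2 = turn_weight v (nth true q k.-1) (nth true q k).
Proof.
move=> kq v v12; rewrite /weight /turn_weight v12.
rewrite -[(_, _)]/(plane_point v) vertices_plane.
have vE : v = nth (0%N, 0%N) (nat_vertices (l, l) q) k by rewrite nth_nat_vertices.
have ksz : (k < size (nat_vertices (l, l) q))%N by rewrite size_nat_vertices.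
rewrite mem_map ?index_map; try exact: plane_point_inj.
have -> : index v (nat_vertices (l, l) q) = k.
  by rewrite vE index_uniq ?nat_vertices_uniq.
have -> // : v \in nat_vertices (l, l) q by rewrite vE mem_nth.
Qed.

Lemma weight_notin l q v : v \notin nat_vertices (l, l) q ->
  weight gamma l q v.1 v.2 = 1.
Proof.
move=> vq; rewrite /weight -[(_, _)]/(plane_point v) vertices_plane.
by rewrite mem_map ?vq //; exact: plane_point_inj.
Qed.

(** Pairs off the path weigh 1 and no vertex is visited twice, so the product over the triangle is
    one over the vertices of positive height; both endpoints lie on the axis. *)
Lemma prod_weight l m q : nat_end l q = (m, m) ->
  \prod_(l <= i < m.+1) \prod_(i.+1 <= j < m.+1) weight gamma l q i j
  = path_weight l q.
Proof.
move=> qm; pose w v := weight gamma l q v.1 v.2.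
transitivity (\prod_(v <- nat_vertices (l, l) q | (v.1 < v.2)%N) w v).
  transitivity (\prod_(v <- [seq (i, j) | i <- index_iota l m.+1,
                                          j <- index_iota i.+1 m.+1]) w v).
    by rewrite big_allpairs_dep.
  rewrite (bigID (mem (nat_vertices (l, l) q))) /= [X in _ * X]big1 ?mulr1; last first.
    by move=> v; exact: weight_notin.
  rewrite -[LHS]big_filter -[RHS]big_filter.
  apply: perm_big; apply: uniq_perm.
  - apply: filter_uniq; apply: allpairs_uniq_dep => [|i _|]; rewrite ?iota_uniq //.
    by move=> [i j] [i' j'] _ _ /= [-> ->].
  - exact/filter_uniq/nat_vertices_uniq.
  move=> [i j]; rewrite !mem_filter /= andbC; case: (boolP (_ \in _ :: _)); last first.
    by rewrite !andbF.
  move=> /(nthP (0%N, 0%N)) [k]; rewrite size_nat_vertices ltnS => kq.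
  rewrite nth_nat_vertices // => vE; rewrite !andbT.
  (* Coordinates never decrease along a path, so every vertex lies between [(l, l)] and [(m, m)],
     within the ranges of the product. *)
  have := foldl_nat_step_ge (l, l) (take k q); rewrite vE /= => /andP[li _].
  have := foldl_nat_step_ge (i, j) (drop k q).
  rewrite -vE -foldl_cat cat_take_drop -/(nat_end l q) qm vE /= => /andP[im jm].
  apply/allpairsPdep/idP => [[i' [j' []]]|ij].
    by rewrite !mem_index_iota => _ + [-> ->] => /andP[].
  by exists i, j; rewrite !mem_index_iota li ij; split.
rewrite big_mkcond (big_nth (0%N, 0%N)) size_nat_vertices big_ltn //.
rewrite nth_nat_vertices // take0 ltnn Monoid.mul1m.
(* On the empty path the first and last vertices coincide and cannot both be split off. *)
have [q0|q0] := posnP (size q); first by rewrite /path_weight q0 !big_geq.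
rewrite big_nat_recr //= [X in _ * X]ifF ?mulr1.
  apply: eq_big_nat => k /andP[k0 /ltnW kq]; rewrite nth_nat_vertices //.
  case: ifP => v12; first exact: weight_nat_vertices.
  by rewrite /turn_weight v12.
by rewrite nth_nat_vertices // take_size -/(nat_end l q) qm ltnn.
Qed.

Lemma big_tuple_rcons (n : nat) (P : pred (seq bool)) (F : seq bool -> R[i]) :
  \sum_(q : n.+1.-tuple bool | P q) F q =
  \sum_(q : n.-tuple bool) \sum_(b : bool | P (rcons q b)) F (rcons q b).
Proof.
rewrite pair_big_dep /=.
pose h (x : n.-tuple bool * bool) := [tuple of rcons x.1 x.2].
rewrite (reindex h) //; apply/onW_bij/inj_card_bij.
  by move=> [q b] [q' b'] /(congr1 val) /= /rcons_inj[] /val_inj -> ->.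
by rewrite card_prod !card_tuple card_bool expnSr.
Qed.

(** The extra step [b] only settles the turn at [v]; it is not itself required to stay above the
    axis. *)
Definition amplitude l n (v : nat * nat) (b : bool) : R[i] :=
  \sum_(q : n.-tuple bool | nonneg_path l q && (nat_end l q == v))
     path_weight l (rcons q b).

Lemma amplitudeS l n i j b : (i <= j)%N ->
  amplitude l n.+1 (i, j) b =
  (if j is j'.+1 then amplitude l n (i, j') true * turn_weight (i, j) true b else 0) +
  (if i is i'.+1 then amplitude l n (i', j) false * turn_weight (i, j) false b else 0).
Proof.
move=> ij; rewrite /amplitude.
rewrite (big_tuple_rcons n (fun q => nonneg_path l q && (nat_end l q == (i, j)))
  (fun q => path_weight l (rcons q b))).
under eq_bigr => q _.
  rewrite big_mkcond big_bool /= !nonneg_path_rcons !nat_end_rcons /=.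
  over.
rewrite big_split /=; congr (_ + _).
  case: j ij => [|j] ij.
    by rewrite big1 // => q _; rewrite xpair_eqE andbC; case: ifP => // /andP[/andP[]].
  rewrite mulr_suml [RHS]big_mkcond; apply: eq_bigr => q _.
  case: (nat_end l q) (@nat_end_rcons l q true) => i1 j1 /= qE.
  rewrite !xpair_eqE eqSS -andbA path_weight_rcons qE.
  case: (boolP ((i1 == i) && (j1 == j))) => [/andP[/eqP-> /eqP->]|]; last first.
    by rewrite !andbF.
  by rewrite ij.
case: i ij => [|i] ij.
  by rewrite big1 // => q _; rewrite xpair_eqE /= andbF.
rewrite mulr_suml [RHS]big_mkcond; apply: eq_bigr => q _.
case: (nat_end l q) (@nat_end_rcons l q false) => i1 j1 /= qE.
rewrite !xpair_eqE eqSS -andbA path_weight_rcons qE.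
case: (boolP ((i1 == i) && (j1 == j))) => [/andP[/eqP-> /eqP->]|]; last first.
  by rewrite !andbF.
by rewrite ij.
Qed.

Lemma amplitude_eq0 l n i j b : ~~ (l <= i <= j)%N -> amplitude l n (i, j) b = 0.
Proof.
move=> lij; apply: big1 => q /andP[/nonneg_path_end + /eqP qE].
rewrite qE /= => ij; have := foldl_nat_step_ge (l, l) q.
by rewrite -/(nat_end l q) qE /= => /andP[li _]; rewrite li ij in lij.
Qed.

Section Transfer.
Variables (l : nat) (rise fall : nat -> nat -> R[i]).
Hypothesis rise_source : rise l l = 1.
Hypothesis fall_source : forall j, (l < j)%N -> fall l j = 0.
Hypothesis rise_diag : forall i, (l < i)%N -> rise i i = fall i i.
Hypothesis riseS : forall i j, (l <= i <= j)%N ->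
  rise i j.+1 =
  julia_d (gamma i j.+1) * rise i j - Num.conj (gamma i j.+1) * fall i j.+1.
Hypothesis fallS : forall i j, (l <= i <= j)%N ->
  fall i.+1 j.+1 = gamma i j.+1 * rise i j + julia_d (gamma i j.+1) * fall i j.+1.

(* [rise i j] and [fall i.+1 j] are the amplitudes on the edges that leave the
   point [(i, j)] upwards and downwards. *)
Lemma amplitudeE n i j b : (l <= i <= j)%N -> (i + j = l + l + n)%N -> b || (i < j)%N ->
  amplitude l n (i, j) b = if b then rise i j else fall i.+1 j.
Proof.
elim: n i j b => [|n IHn] i j b /andP[li ij] ijn bij.
  have il : i = l by lia.
  have jl : j = l by lia. subst i j.
  rewrite ltnn orbF in bij; rewrite bij rise_source /amplitude.
  rewrite (big_pred1 [tuple]) => [|q]; last first.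
    by rewrite tuple0 /= /nonneg_path /= leqnn !eqxx.
  by rewrite /path_weight big_geq.
rewrite amplitudeS //; move: ij; rewrite leq_eqVlt => /predU1P[ij|ij].
  (* On the axis a path arrives by a fall, the turn weighs 1, and [rise_diag] turns the arriving
     fall into the departing rise. *)
  subst j; rewrite ltnn orbF in bij; case: b bij => // _.
  case: i li ijn => [|i] li ijn; first by lia.
  rewrite amplitude_eq0 ?ltnn ?andbF // mul0r add0r /turn_weight ltnn mulr1.
  by rewrite IHn /= ?rise_diag ?leqnSn ?andbT //; lia.
case: j ij ijn bij => // j ij ijn _.
have ij' : (l <= i <= j)%N by rewrite li.
(* For [i = l] no path arrives by a fall, in agreement with [fall_source]. *)
have amp2 : (if i is i'.+1 then amplitude l n (i', j.+1) false
       * turn_weight (i, j.+1) false b else 0)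
    = fall i j.+1 * turn_weight (i, j.+1) false b.
  case: (ltngtP l i) li => // [li|il] _; last first.
    subst i; rewrite fall_source // mul0r; case: (l) => // l'.
    by rewrite amplitude_eq0 ?mul0r ?ltnn.
  case: i li ij ijn {ij'} => // i li ij ijn; rewrite IHn //=; lia.
rewrite amp2 IHn //=; last by lia.
rewrite /turn_weight /= ij; case: b {amp2} => /=.
  by rewrite riseS // mulrN ![_ * rise _ _]mulrC ![_ * fall _ _]mulrC.
by rewrite fallS // ![_ * rise _ _]mulrC ![_ * fall _ _]mulrC.
Qed.

(** A rise appended at [(m, m)] adds a turn on the axis, of weight 1, so the sum is an amplitude. *)
Lemma dyck_sum m : (l <= m)%N ->
  \sum_(q in dyck_paths l m)
     \prod_(l <= i < m.+1) \prod_(i.+1 <= j < m.+1) weight gamma l q i j = rise m m.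
Proof.
move=> lm; rewrite -(@amplitudeE (2 * (m - l)) m m true) ?lm ?leqnn //; last by lia.
apply: eq_big => [q|q]; first exact: mem_dyck_paths.
rewrite mem_dyck_paths => /andP[_ /eqP qm]; rewrite prod_weight //.
case/lastP: (tval q) qm => [|s c] qm; first by rewrite /path_weight !big_geq.
by rewrite path_weight_rcons qm /turn_weight ltnn mulr1.
Qed.

End Transfer.
End PathSum.

(** * The characterization *)

Local Open Scope complex_scope.

(** Positive values are real in the order of [R[i]]. Reality of the quadratic form at the vectors
    [(1, 1)] and [(1, 'i)] gives two equations that determine [K m l]. *)
Lemma spd_hermitian (R : realType) (K : nat -> nat -> R[i]) :
  (forall l, K l l = 1) -> strictly_positive_definite K -> hermitian_kernel K.
Proof.
move=> K1 Kspd l m; have [->|lm] := eqVneq l m; first by rewrite K1 conjC1.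
pose p (k : 'I_2) := if k == ord0 then l else m.
have p_inj : injective p.
  move=> [[|[|//]] ?] [[|[|//]] ?]; rewrite /p /= => e; apply/val_inj => //=;
  by move/eqP: e; rewrite ?(negPf lm) ?[m == l]eq_sym ?(negPf lm).
have H (x : R[i]) : (1 + K l m * x + (K m l * Num.conj x + x * Num.conj x))
    \is Num.real.
  pose lam (k : 'I_2) := if k == ord0 then 1 else x.
  have /ltW/ger0_real := Kspd 2%N p lam isT p_inj
    (ex_intro (fun k => lam k != 0) ord0 (oner_neq0 _)).
  rewrite !big_ord_recr !big_ord0 /= /p /lam /= !K1 conjC1 !add0r !mulr1 mul1r.
  by [].
have /CrealP := H 1; have /CrealP := H 'i%R.
rewrite !(rmorphD, rmorphM, rmorph1) /= !conjCK conjCi ?conjC1.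
move: (K l m) (K m l) => a b ei e1.
have : 2 * 'i%R * (b - Num.conj a) = 0.
  have /eqP := ei; have /eqP := e1; rewrite -subr_eq0 => /eqP E1.
  rewrite -subr_eq0 => /eqP Ei.
  transitivity (0 - 'i%R * 0 : R[i]); last by rewrite mulr0 subr0.
  rewrite -[X in _ = X - _]Ei -[X in _ = _ - _ * X]E1; ring.
move/eqP; rewrite !mulf_eq0 pnatr_eq0 /= (negPf (neq0Ci _)) subr_eq0.
by move/eqP.
Qed.

Lemma kform_spd_gt0 (R : realType) (K : nat -> nat -> R[i]) (q : {poly R[i]}) :
  strictly_positive_definite K -> q != 0 -> 0 < kform K q q.
Proof.
move=> Kspd q0; apply: (Kspd _ val (fun k => q`_k)); rewrite ?size_poly_gt0 //.
  exact: val_inj.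
have sq : ((size q).-1 < size q)%N by rewrite prednK ?size_poly_gt0.
by exists (Ordinal sq); rewrite /= -lead_coefE lead_coef_eq0.
Qed.

(** The quadratic form is the squared norm of a combination of the [w (p j)]. Among the indices with
    [lam k != 0], the one with the largest [p k] is alone in its degree, so the combination is
    nonzero. *)
Lemma spd_gram (R : realType) (K : nat -> nat -> R[i]) (w : nat -> {poly R[i]}) :
  (forall k, size (w k) = k.+1) ->
  (forall l m, K l m = kform (delta_kernel R[i]) (w m) (w l)) ->
  strictly_positive_definite K.
Proof.
move=> sw Kw n p lam n0 p_inj [k0 lam0].
have -> : \sum_(k < n) \sum_(j < n) K (p k) (p j) * lam j * Num.conj (lam k) =
    kform (delta_kernel R[i]) (\sum_j lam j *: w (p j)) (\sum_j lam j *: w (p j)).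
  rewrite kform_sumr; last exact: delta_kernel_herm.
  apply: eq_bigr => k _; rewrite kform_suml; apply: eq_bigr => j _.
  rewrite kformZl kformZr; last exact: delta_kernel_herm.
  by rewrite -Kw; ring.
apply: kform_delta_gt0.
case: (@arg_maxnP _ k0 (fun k => lam k != 0) p lam0) => k lamk kmax.
apply/eqP => /(congr1 (fun q : {poly R[i]} => q`_(p k))) /eqP.
rewrite coef_sum coef0 (bigD1 k) //= big1 ?addr0 => [|j jk].
  have -> : (lam k *: w (p k))`_(p k) = lam k * lead_coef (w (p k)).
    by rewrite coefZ lead_coefE sw.
  by rewrite mulf_eq0 (negPf lamk) lead_coef_eq0 -size_poly_eq0 sw.
rewrite coefZ; have [->|lamj] := eqVneq (lam j) 0; first by rewrite mul0r.
rewrite nth_default ?mulr0 // sw ltn_neqAle (inj_eq p_inj) jk.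
exact: kmax.
Qed.

Theorem theorem2p2 (R : realType) (K : nat -> nat -> R[i])
    (K1 : forall l, K l l = 1) :
  strictly_positive_definite K <->
  (hermitian_kernel K /\
   exists gamma : nat -> nat -> R[i],
     (forall k j, (k < j)%N -> `|gamma k j| < 1) /\
     (forall l m, (l < m)%N ->
        K l m = \sum_(q in dyck_paths l m)
                  \prod_(l <= i < m.+1) \prod_(i.+1 <= j < m.+1)
                    weight gamma l q i j)).
Proof.
split=> [Kspd|[Kherm [gamma [gamma1 Kgamma]]]].
  have Kherm := spd_hermitian K1 Kspd; split=> //.
  have Kpos p : p != 0 -> 0 < kform K p p by apply: kform_spd_gt0.
  exists (schur_param K); split=> [k j|l m lm]; first exact: norm_schur_param.
  pose rise i j := kform K (rise_vec K i j) 'X^l.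
  pose fall i j := kform K (fall_vec K i j) 'X^l.
  have rd i : rise i i = K l i by rewrite /rise /rise_vec subnn kformXn.
  have fd i : fall i i = K l i by rewrite /fall /fall_vec subnn kformXn.
  rewrite (@dyck_sum _ (schur_param K) l rise fall) ?rd ?K1 ?(ltnW lm) //.
  - move=> j lj; have sP := schurP Kherm K1 Kpos (j - l) l.
    by apply: (schur_fall_ortho sP); lia.
  - by move=> i _; rewrite rd fd.
  - move=> i j /andP[_ ij].
    by rewrite /rise rise_vecS // -scaleNr kformDl !kformZl mulNr.
  - move=> i j /andP[_ ij].
    by rewrite /fall fall_vecS // kformDl !kformZl.
pose w k := cascade_fall gamma k k.
have sw k : size (w k) = k.+1 by apply: size_cascade_fall.
apply: (spd_gram sw).
have Klm l m : (l < m)%N -> K l m = kform (delta_kernel R[i]) (w m) (w l).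
  move=> lm; rewrite Kgamma //.
  pose rise i j := kform (delta_kernel R[i]) (cascade_rise_vec gamma i j) (w l).
  pose fall i j := kform (delta_kernel R[i]) (cascade_fall gamma i j) (w l).
  have rd i : rise i i = fall i i by rewrite /rise cascade_rise_vecii.
  rewrite (@dyck_sum _ gamma l rise fall) ?rd ?(ltnW lm) //.
  - by rewrite /fall cascade_fall_orthonormal // eqxx.
  - move=> j lj; rewrite /fall cascade_fall_orthonormal ?(gtn_eqF lj) //; exact: ltnW.
  - move=> i j /andP[_ ij].
    by rewrite /rise cascade_rise_vecS // -scaleNr kformDl !kformZl mulNr.
  - by move=> i j /andP[_ ij]; rewrite /fall cascade_fallS kformDl !kformZl.
(* The path formula settles [l < m]; Hermitian symmetry and the unit diagonal give the rest. *)
move=> l m; case: (ltngtP l m) => [|ml|->]; first exact: Klm.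
  by rewrite Kherm Klm // -kform_herm //; exact: delta_kernel_herm.
by rewrite K1 cascade_fall_orthonormal // eqxx.
Qed.
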